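(* Let $R\in\mathbb{R}^{m\times N}$, $\lambda\in\mathbb{R}^N$ with $\lambda\ge 0$, $\nu\in\mathbb{R}$ and $\beta>0$, and let $d_i\in\mathbb{R}^m$ with $\|d_i\|=1$ be the current atom. Consider the problem $$\min_{d\in\mathbb{R}^m:\ \|d\|=1,\ x\in\mathbb{R}^{1\times N}}\ \frac12\|d\,x-R\|_F^2+\beta\|x\|_2-\nu\,x\lambda .$$ Let $$d^*\in\arg\min_{\|v\|=1}\ -\frac12\|R^Tv+\nu\lambda\|_2^2 .$$ Then a solution $(d_i^+,(x^i)^+)$ (global minimizer) of this problem is given as follows. (i) If $\|R^Td^*+\nu\lambda\|\ge\beta$, then $$d_i^+=d^*,\qquad (x^i)^+=\left(1-\frac{\beta}{\|R^Td_i^++\nu\lambda\|}\right)(R^Td_i^++\nu\lambda)^T .$$ (ii) Otherwise, when $\|R^Td^*+\nu\lambda\|<\beta$, $(d_i^+,(x^i)^+)=(d_i,0)$.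
   Context: $\|\cdot\|$ and $\|\cdot\|_2$ denote the Euclidean norm of a (row or column) vector, and $\|\cdot\|_F$ the Frobenius norm. Background: this is one K-SVD-type step for the combined dictionary learning / one-class SVM (OC-SVM) objective $\frac12\|Y-DX\|_F^2+\beta\sum_i\|x^i\|_2+G(X,\omega,\rho,\xi)$, where $d_i$ is the $i$-th (unit-norm) column (atom) of the dictionary $D$, $x^i$ is the $i$-th row of the representation matrix $X$, $R=Y-\sum_{j\ne i}d_jx^j$ is the residual without the contribution of the pair $(d_i,x^i)$, $\nu=\omega_i$ is the component of the OC-SVM normal vector $\omega$ corresponding to the atom $d_i$, and $\lambda$ is the vector of OC-SVM Lagrange multipliers. By the K-SVD convention, $R$, $x^i$ and $\lambda$ may be restricted to the columns/entries of the signals that use atom $d_i$ in their representation; $N$ then denotes the number of these. *)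

(* Defs.v *)
From mathcomp Require Import all_boot all_order all_algebra.
From mathcomp Require Import reals.

Set Implicit Arguments.
Unset Strict Implicit.
Unset Printing Implicit Defensive.

Import Order.TTheory GRing.Theory Num.Theory.
Local Open Scope ring_scope.

(* Square root of the sum of the squared entries: the Frobenius norm of a
   matrix, which for a matrix with a single row or a single column is the
   Euclidean norm of that vector. (The norm that MathComp-Analysis puts on
   matrices is the max norm.) *)
Definition norm2 (K : realType) (m n : nat) (A : 'M[K]_(m, n)) : K :=
  Num.sqrt (\sum_(i < m) \sum_(j < n) A i j ^+ 2).

Definition is_argmin (K : realType) (T : Type) (C : T -> Prop) (f : T -> K)
    (x : T) : Prop :=
  C x /\ (forall y : T, C y -> f x <= f y).

Definition unit_vec (K : realType) (m : nat) (v : 'cV[K]_m) : Prop :=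
  norm2 v = 1.

Definition atom_objective (K : realType) (m N : nat) (R : 'M[K]_(m, N))
    (lam : 'cV[K]_N) (nu : K) (v : 'cV[K]_m) : K :=
  - (1 / 2 * norm2 (R^T *m v + nu *: lam) ^+ 2).

(* [x *m lam] is a 1 x 1 matrix; its entry is the scalar x lambda. *)
Definition pair_objective (K : realType) (m N : nat) (R : 'M[K]_(m, N))
    (lam : 'cV[K]_N) (nu beta : K) (p : 'cV[K]_m * 'rV[K]_N) : K :=
  let: (d, x) := p in
  1 / 2 * norm2 (d *m x - R) ^+ 2 + beta * norm2 x - nu * (x *m lam) 0 0.

Definition pair_solution (K : realType) (m N : nat) (R : 'M[K]_(m, N))
    (lam : 'cV[K]_N) (nu beta : K) (d : 'cV[K]_m) (x : 'rV[K]_N) : Prop :=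
  is_argmin (fun p : 'cV[K]_m * 'rV[K]_N => unit_vec p.1)
    (pair_objective R lam nu beta) (d, x).

(* Main.v *)
(* For a unit atom d, put u = R^T d + nu lam.  Expanding the squared Frobenius
   norm turns the objective into |x|^2 / 2 + beta |x| - x u + |R|^2 / 2, and by
   Cauchy-Schwarz x u <= |x| |u| <= |x| S, where S is the maximum of |u| over
   unit atoms, attained at dstar.  The scalar function t^2 / 2 + (beta - S) t
   on t >= 0 is minimized at t = max (S - beta) 0, and the bound is attained
   at x = 0 for any unit d if S < beta, and for d = dstar, x parallel to u
   otherwise. *)
Require Import Defs.
From mathcomp Require Import all_boot all_order all_algebra.
From mathcomp Require Import reals ring lra.

Import Order.TTheory GRing.Theory Num.Theory.
Local Open Scope ring_scope.

Lemma norm2_ge0 (K : realType) (m n : nat) (A : 'M[K]_(m, n)) : 0 <= norm2 A.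
Proof. exact: sqrtr_ge0. Qed.

(** In this form, linearity and cyclicity of the trace replace manipulations of double sums in the
    norm computations below. *)
Lemma norm2_sqr (K : realType) (m n : nat) (A : 'M[K]_(m, n)) :
  norm2 A ^+ 2 = \tr (A^T *m A).
Proof.
rewrite sqr_sqrtr; last first.
  by apply: sumr_ge0 => i _; apply: sumr_ge0 => j _; rewrite sqr_ge0.
rewrite exchange_big; apply: eq_bigr => j _; rewrite mxE.
by apply: eq_bigr => i _; rewrite !mxE expr2.
Qed.

Lemma norm2_eq0 (K : realType) (m n : nat) (A : 'M[K]_(m, n)) :
  norm2 A = 0 -> A = 0.
Proof.
move=> A0; have rowge0 i : 0 <= \sum_(j < n) A i j ^+ 2.
  by apply: sumr_ge0 => j _; rewrite sqr_ge0.
have /eqP : \sum_(i < m) \sum_(j < n) A i j ^+ 2 = 0.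
  by rewrite -[LHS]sqr_sqrtr ?sumr_ge0 // -/(norm2 A) A0 expr0n.
rewrite psumr_eq0 // => /allP Arow0; apply/matrixP => i j; rewrite mxE.
have := Arow0 i (mem_index_enum i).
rewrite /= psumr_eq0; last by move=> k _; rewrite sqr_ge0.
by move=> /allP /(_ j (mem_index_enum j)); rewrite /= sqrf_eq0 => /eqP.
Qed.

Lemma norm2_0 (K : realType) (m n : nat) : norm2 (0 : 'M[K]_(m, n)) = 0.
Proof. by apply/eqP; rewrite -sqrf_eq0 norm2_sqr mulmx0 mxtrace0. Qed.

Lemma norm2_tr (K : realType) (m n : nat) (A : 'M[K]_(m, n)) :
  norm2 A^T = norm2 A.
Proof.
apply/eqP; rewrite -(eqrXn2 (n := 2)) ?norm2_ge0 //.
by rewrite !norm2_sqr trmxK mxtrace_mulC.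
Qed.

Lemma norm2Z (K : realType) (m n : nat) (a : K) (A : 'M[K]_(m, n)) :
  norm2 (a *: A) = `|a| * norm2 A.
Proof.
apply/eqP; rewrite -(eqrXn2 (n := 2)) ?mulr_ge0 ?norm2_ge0 //.
rewrite exprMn real_normK ?num_real // !norm2_sqr [(a *: A)^T]linearZ /= -scalemxAl.
by rewrite -scalemxAr !mxtraceZ mulrA expr2.
Qed.

Lemma norm2B_sqr (K : realType) (m n : nat) (A B : 'M[K]_(m, n)) :
  norm2 (A - B) ^+ 2 = norm2 A ^+ 2 - 2 * \tr (A^T *m B) + norm2 B ^+ 2.
Proof.
have trC : \tr (B^T *m A) = \tr (A^T *m B).
  by rewrite -mxtrace_tr trmx_mul trmxK.
rewrite !norm2_sqr [(A - B)^T]linearB /= mulmxBl !mulmxBr !linearB /= trC.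
ring.
Qed.

(** Expand [0 <= |(|B| A - |A| B)|^2] and divide by [2 |A| |B|]; a matrix of norm zero vanishes and
    is treated apart. *)
Lemma mxtrace_cauchy_schwarz (K : realType) (m n : nat) (A B : 'M[K]_(m, n)) :
  \tr (A^T *m B) <= norm2 A * norm2 B.
Proof.
have [A0|Apos] := eqVneq (norm2 A) 0.
  by rewrite A0 (norm2_eq0 _ _ _ _ A0) trmx0 mul0mx mxtrace0 mul0r.
have [B0|Bpos] := eqVneq (norm2 B) 0.
  by rewrite B0 (norm2_eq0 _ _ _ _ B0) mulmx0 mxtrace0 mulr0.
have AB : 0 < norm2 A * norm2 B by rewrite mulr_gt0 // lt0r norm2_ge0 ?Apos ?Bpos.
have := sqr_ge0 (norm2 (norm2 B *: A - norm2 A *: B)).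
rewrite norm2B_sqr !norm2Z !ger0_norm ?norm2_ge0 // [(_ *: A)^T]linearZ /=.
rewrite -scalemxAl -scalemxAr !mxtraceZ => H.
rewrite -(ler_pM2l AB); nra.
Qed.

Lemma mulmx_rV_cV_le (K : realType) (n : nat) (x : 'rV[K]_n) (u : 'cV[K]_n) :
  (x *m u) 0 0 <= norm2 x * norm2 u.
Proof.
by rewrite -trace_mx11 -{1}[x]trmxK -[norm2 x]norm2_tr mxtrace_cauchy_schwarz.
Qed.

(** Since [d^T d = 1], the factor [d] drops out of [|d x|], and the cross term of the square merges
    with [nu x lam]. *)
Lemma pair_objective_unit (K : realType) (m N : nat) (R : 'M[K]_(m, N))
    (lam : 'cV[K]_N) (nu beta : K) (d : 'cV[K]_m) (x : 'rV[K]_N) :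
  unit_vec d ->
  pair_objective R lam nu beta (d, x) =
    1 / 2 * norm2 x ^+ 2 + beta * norm2 x - (x *m (R^T *m d + nu *: lam)) 0 0
      + 1 / 2 * norm2 R ^+ 2.
Proof.
move=> d1; rewrite /pair_objective norm2B_sqr.
have dd : d^T *m d = 1%:M.
  by rewrite [LHS]mx11_scalar -trace_mx11 -norm2_sqr d1 expr1n.
have -> : norm2 (d *m x) ^+ 2 = norm2 x ^+ 2.
  by rewrite !norm2_sqr trmx_mul mulmxA -(mulmxA x^T) dd mulmx1.
(* Transposing gives the trace of [R^T d x]; cyclicity then moves [x] to the front. *)
have -> : \tr ((d *m x)^T *m R) = (x *m (R^T *m d)) 0 0.
  rewrite -trace_mx11 -mxtrace_tr trmx_mul trmxK mxtrace_mulC -mulmxA.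
  by rewrite mxtrace_mulC mulmxA.
rewrite -!trace_mx11 mulmxDr -scalemxAr mxtraceD mxtraceZ; lra.
Qed.

Lemma pair_objective_ge (K : realType) (m N : nat) (R : 'M[K]_(m, N))
    (lam : 'cV[K]_N) (nu beta : K) (dstar d : 'cV[K]_m) (x : 'rV[K]_N) :
  is_argmin (@unit_vec K m) (atom_objective R lam nu) dstar ->
  unit_vec d ->
  1 / 2 * norm2 x ^+ 2 + (beta - norm2 (R^T *m dstar + nu *: lam)) * norm2 x
    + 1 / 2 * norm2 R ^+ 2
  <= pair_objective R lam nu beta (d, x).
Proof.
move=> [_ hmin] d1; rewrite pair_objective_unit //.
(* [atom_objective] is minus half the squared norm, so its minimizer maximizes the norm. *)
have le_norm : norm2 (R^T *m d + nu *: lam) <= norm2 (R^T *m dstar + nu *: lam).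
  rewrite -(ler_pXn2r (n := 2)) ?nnegrE ?norm2_ge0 //.
  by have := hmin d d1; rewrite /atom_objective; lra.
have := mulmx_rV_cV_le _ _ x (R^T *m d + nu *: lam).
have := ler_wpM2l (norm2_ge0 _ _ _ x) le_norm.
lra.
Qed.

Theorem theorem1 (K : realType) (m N : nat) (R : 'M[K]_(m, N))
    (lam : 'cV[K]_N) (nu beta : K) (di dstar : 'cV[K]_m)
    (hlam : forall j : 'I_N, 0 <= lam j 0)
    (hbeta : 0 < beta)
    (hdi : unit_vec di)
    (hdstar : is_argmin (@unit_vec K m) (atom_objective R lam nu) dstar) :
  (beta <= norm2 (R^T *m dstar + nu *: lam) ->
     pair_solution R lam nu beta dstar
       ((1 - beta / norm2 (R^T *m dstar + nu *: lam))
          *: (R^T *m dstar + nu *: lam)^T))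
  /\
  (norm2 (R^T *m dstar + nu *: lam) < beta ->
     pair_solution R lam nu beta di 0).
Proof.
set u := R^T *m dstar + nu *: lam.
have [hds _] := hdstar.
(* In both cases it remains to show that the candidate's value is at most the lower bound, a
   quadratic in [norm2 x]. *)
split=> hS; split=> // -[d x] d1;
  apply: le_trans (pair_objective_ge _ _ _ _ _ _ beta _ _ x hdstar d1);
  rewrite pair_objective_unit // -/u.
- have S0 : 0 < norm2 u by apply: lt_le_trans hbeta hS.
  (* A nonnegative factor leaves no absolute value: the candidate has norm [norm2 u - beta]. *)
  have c0 : 0 <= 1 - beta / norm2 u by rewrite subr_ge0 ler_pdivrMr ?mul1r.
  rewrite norm2Z norm2_tr ger0_norm // -trace_mx11 -scalemxAl mxtraceZ.
  rewrite -norm2_sqr mulrBl mul1r divfK ?gt_eqF //.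
  have -> : (1 - beta / norm2 u) * norm2 u ^+ 2 = (norm2 u - beta) * norm2 u.
    by field; rewrite gt_eqF.
  (* Completing the square: the two sides differ by exactly half of this square. *)
  have := sqr_ge0 (norm2 x - (norm2 u - beta)); nra.
(* At [x = 0] only [|R|^2 / 2] remains; the other terms of the bound are nonnegative as
   [norm2 u < beta]. *)
- rewrite norm2_0 mul0mx mxE.
  have := sqr_ge0 (norm2 x).
  have : 0 <= (beta - norm2 u) * norm2 x.
    by rewrite mulr_ge0 ?norm2_ge0 // subr_ge0 ltW.
  lra.
Qed.
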